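(* Let $X$ and $Y$ be $G$-spaces. If there exists a $G$-map $g\colon Y\to X$ with a left homotopy inverse, then $\mathrm{cat}_G^{\#}(X)\ge \mathrm{cat}_G^{\#}(Y)$. In particular, $\mathrm{cat}_G^{\#}$ is a $G$-homotopy invariant of $G$-spaces.
   Context: For a $G$-space $X$ ($G$ a topological group), $\mathrm{cat}_G^{\#}(X)$ (the LS category of $X$ with respect to $G$) is the smallest $n$ such that $X$ has an open cover $\{U_1,\dots,U_n\}$ by $G$-invariant sets each of which is categorical, i.e. the inclusion $U_i\hookrightarrow X$ is null-homotopic (no equivariance required of the homotopy); it is $\infty$ if no such $n$ exists. A left homotopy inverse of $g$ is a continuous map $h\colon X\to Y$ (not necessarily a $G$-map) with $h\circ g\simeq \mathrm{id}_Y$. *)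

(* Defs.v *)
From HB Require Import structures.
From mathcomp Require Import all_boot all_order all_algebra.
From mathcomp Require Import all_classical all_reals all_analysis.

Set Implicit Arguments.
Unset Strict Implicit.
Unset Printing Implicit Defensive.

Import Order.TTheory GRing.Theory Num.Theory.
Import numFieldNormedType.Exports.

Local Open Scope classical_set_scope.
Local Open Scope ring_scope.

HB.mixin Record Topological_isTopologicalGroup G
    & Group G & Topological G := {
  mulg_continuous : continuous (fun p : G * G => (p.1 * p.2)%g) ;
  invg_continuous : continuous (fun x : G => (x^-1)%g) }.

#[short(type="topologicalGroupType")]
HB.structure Definition TopologicalGroup :=
  {G of Topological_isTopologicalGroup G & Group G & Topological G}.

HB.mixin Record Topological_isGSpace (G : topologicalGroupType) X
    & Topological X := {
  gact : G -> X -> X ;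
  gact1 : forall x : X, gact 1%g x = x ;
  gactM : forall (a b : G) (x : X), gact (a * b)%g x = gact a (gact b x) ;
  gact_continuous : continuous (fun p : G * X => gact p.1 p.2) }.

#[short(type="gSpaceType")]
HB.structure Definition GSpace (G : topologicalGroupType) :=
  {X of Topological_isGSpace G X & Topological X}.

Arguments gact {G s} _ _.

(* A map with domain a subspace [A] of [X] is represented by a total function
   on [X], of which only the values on [A] matter. *)
Definition homotopic_on (R : realType) (X Y : topologicalType) (A : set X)
    (f g : X -> Y) : Prop :=
  exists H : X * R -> Y,
    [/\ {within A `*` `[0, 1], continuous H},
        (forall x, A x -> H (x, 0) = f x) &
        (forall x, A x -> H (x, 1) = g x)].

Definition homotopic (R : realType) (X Y : topologicalType) (f g : X -> Y) :=
  homotopic_on R setT f g.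

Definition categorical (R : realType) (X : topologicalType) (U : set X) : Prop :=
  exists x0 : X, homotopic_on R U id (cst x0).

Section GSpaces.
Variables (R : realType) (G : topologicalGroupType).

Definition left_homotopy_inverse (X Y : topologicalType)
    (g : Y -> X) (h : X -> Y) : Prop :=
  continuous h /\ homotopic R (h \o g) id.

Definition G_invariant (X : gSpaceType G) (U : set X) : Prop :=
  forall (a : G) (x : X), U x -> U (gact a x).

Definition G_equivariant (X Y : gSpaceType G) (f : X -> Y) : Prop :=
  forall (a : G) (x : X), f (gact a x) = gact a (f x).

Definition G_map (X Y : gSpaceType G) (f : X -> Y) : Prop :=
  continuous f /\ G_equivariant f.

Definition G_homotopic (X Y : gSpaceType G) (f g : X -> Y) : Prop :=
  exists H : X * R -> Y,
    [/\ {within setT `*` `[0, 1], continuous H},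
        (forall x, H (x, 0) = f x),
        (forall x, H (x, 1) = g x) &
        (forall t : R, t \in `[0, 1] -> G_equivariant (fun x => H (x, t)))].

Definition G_homotopy_equivalent (X Y : gSpaceType G) : Prop :=
  exists (f : X -> Y) (g : Y -> X),
    [/\ G_map f, G_map g,
        G_homotopic (g \o f) id & G_homotopic (f \o g) id].

(* [n = 0] is allowed; it only ever occurs for the empty space. *)
Definition categorical_cover (X : gSpaceType G) (n : nat) : Prop :=
  exists U : 'I_n -> set X,
    \bigcup_i U i = setT /\
    forall i, [/\ open (U i), G_invariant (U i) & categorical R (U i)].

Definition LScat (X : gSpaceType G) : \bar R :=
  match pselect (exists n, `[< categorical_cover X n >]) with
  | left ex => ((ex_minn ex)%:R)%:E
  | right _ => +oo%E
  end.

End GSpaces.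

(* Main.v *)
Require Import Defs.
From HB Require Import structures.
From mathcomp Require Import all_boot all_order all_algebra.
From mathcomp Require Import all_classical all_reals all_analysis.
From mathcomp Require Import lra.

(** Let [h] be a left homotopy inverse of the G-map [g : Y -> X].  If [U] is a
    G-invariant categorical open set of [X], then its preimage [V] under [g] is
    open because [g] is continuous and G-invariant because [g] is equivariant.
    It is also categorical in [Y]: on [V], the identity is homotopic to
    [h \o g], and [h \o g] factors through the inclusion of [U] in [X], which
    contracts to a point [x0]; so [V] contracts to [h x0].  Hence a categorical
    cover of [X] pulls back to one of [Y] with as many members
    ([categorical_preimage], [categorical_cover_preimage]), which gives the
    inequality.

    Both maps of a G-homotopy equivalence have left homotopy inverses, since a
    G-homotopy is in particular a homotopy; the two inequalities then give the
    invariance. *)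

Set Implicit Arguments.
Unset Strict Implicit.
Unset Printing Implicit Defensive.

Import Order.TTheory GRing.Theory Num.Theory.
Import numFieldNormedType.Exports.

Local Open Scope classical_set_scope.
Local Open Scope ring_scope.

Lemma continuous_pair (X Y Z : topologicalType) (f : X -> Y) (g : X -> Z) :
  continuous f -> continuous g -> continuous (fun x => (f x, g x)).
Proof. by move=> fc gc x; exact: (cvg_pair (fc x) (gc x)). Qed.

Lemma continuous_comp_within (X Y Z : topologicalType) (A : set X) (B : set Y)
    (k : X -> Y) (f : Y -> Z) :
  continuous k -> (forall x, A x -> B (k x)) ->
  {within B, continuous f} -> {within A, continuous (f \o k)}.
Proof.
move=> kc kAB /subspace_continuousP fc; apply/subspace_continuousP => x Ax W.
move=> Wfkx; have fW : \forall z \near k x, B z -> W (f z).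
  by apply: (fc (k x)) => //; exact: kAB.
have kW : \forall z \near x, B (k z) -> W (f (k z)) by exact: (kc x _ fW).
rewrite /= nbhs_simpl /within /=.
by apply: filterS kW => z BW /kAB; exact: BW.
Qed.

(** Pasting over an [A] that need not be closed, as is the case for homotopies
    over the open members of a cover.  A point outside the closed set [C] has a
    neighbourhood that misses [C], so there the piece over [C] imposes no
    condition; at a point of [C], continuity on that piece applies. *)
Lemma within_continuous_paste (X Y : topologicalType) (A C D : set X)
    (f : X -> Y) :
  closed C -> closed D -> A `<=` C `|` D ->
  {within A `&` C, continuous f} -> {within A `&` D, continuous f} ->
  {within A, continuous f}.
Proof.
move=> Ccl Dcl ACD fC fD; apply/subspace_continuousP => x Ax W Wfx.
have near_piece (E : set X) : closed E -> {within A `&` E, continuous f} ->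
    \forall z \near x, A z -> E z -> W (f z).
  move=> Ecl /subspace_continuousP fE; have [Ex|nEx] := pselect (E x).
    have : \forall z \near x, (A `&` E) z -> W (f z).
      by apply: (fE x) => //; split.
    by apply: filterS => z AEW Az Ez; apply: AEW.
  have : \forall z \near x, (~` E) z.
    by apply: open_nbhs_nbhs; split => //; exact: closed_openC.
  by apply: filterS => z nEz _ /nEz.
rewrite /= nbhs_simpl /within /=.
apply: filterS2 (near_piece C Ccl fC) (near_piece D Dcl fD) => z CW DW Az.
by have [/CW|/DW] := ACD z Az; exact.
Qed.

Section Homotopies.
Variable R : realType.

Lemma homotopic_on_comp (X Y X' Y' : topologicalType) (A : set X) (B : set X')
    (f g : X -> Y) (k : X' -> X) (h : Y -> Y') :
  continuous k -> (forall x, B x -> A (k x)) -> continuous h ->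
  homotopic_on R A f g -> homotopic_on R B (h \o f \o k) (h \o g \o k).
Proof.
move=> kc kBA hc [H [Hc H0 H1]].
exists (h \o (H \o (fun p : X' * R => (k p.1, p.2)))); split.
- have Hkc : {within B `*` `[0, 1],
      continuous (H \o (fun p : X' * R => (k p.1, p.2)))}.
    apply: continuous_comp_within Hc.
      apply: continuous_pair => p; last exact: cvg_snd.
      by apply: continuous_comp; [exact: cvg_fst | exact: kc].
    by move=> [x t] [/= /kBA].
  by move=> p; exact: cvg_comp (Hkc p) (hc _).
- by move=> x /kBA Akx; rewrite /= H0.
- by move=> x /kBA Akx; rewrite /= H1.
Qed.

Lemma homotopic_on_sym (X Y : topologicalType) (A : set X) (f g : X -> Y) :
  homotopic_on R A f g -> homotopic_on R A g f.
Proof.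
move=> [H [Hc H0 H1]].
exists (H \o (fun p : X * R => (p.1, 1 - p.2))); split => [|x Ax|x Ax] /=.
- apply: continuous_comp_within Hc.
    apply: continuous_pair => p; first exact: cvg_fst.
    by apply: cvgB; [exact: cvg_cst | exact: cvg_snd].
  move=> [x t] [/= Ax /[!in_itv] /= t01]; split => //=; lra.
- by rewrite subr0 H1.
- by rewrite subrr H0.
Qed.

(** Run the two homotopies one after the other, each at double speed; the
    half-cylinders of times at most and at least 1/2 are closed. *)
Lemma homotopic_on_trans (X Y : topologicalType) (A : set X) (f g k : X -> Y) :
  homotopic_on R A f g -> homotopic_on R A g k -> homotopic_on R A f k.
Proof.
move=> [H [Hc H0 H1]] [K [Kc K0 K1]].
pose HK (p : X * R) :=
  if p.2 <= 2^-1 then H (p.1, 2 * p.2) else K (p.1, 2 * p.2 - 1).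
exists HK; split; last 2 first.
- by move=> x Ax; rewrite /HK /= ifT ?mulr0 ?H0 // invr_ge0.
- move=> x Ax; rewrite /HK /= ifF; last by apply/negbTE; lra.
  by rewrite (_ : 2 * 1 - 1 = 1) ?K1 //; lra.
have snd_continuous : continuous (snd : X * R -> R) by move=> p; exact: cvg_snd.
have double_continuous : continuous (fun p : X * R => 2 * p.2).
  by move=> p; apply: cvgM; [exact: cvg_cst | exact: cvg_snd].
apply: (@within_continuous_paste _ _ _ (snd @^-1` [set t : R | t <= 2^-1])
    (snd @^-1` [set t : R | 2^-1 <= t])).
- apply: preimage_closed; last exact: closed_le.
  by move=> p _; exact: snd_continuous.
- apply: preimage_closed; last exact: closed_ge.
  by move=> p _; exact: snd_continuous.
- by move=> [x t] _ /=; apply/orP; exact: le_total.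
- apply: (@subspace_eq_continuous _ _ _ (H \o (fun p => (p.1, 2 * p.2)))).
    by move=> [x t] /set_mem [_ /= t_le]; rewrite /from_subspace /HK /= t_le.
  apply: continuous_comp_within Hc.
    by apply: continuous_pair => p; [exact: cvg_fst | exact: double_continuous].
  move=> [x t] [[/= Ax /[!in_itv] /= t01] t_le]; split => //=; lra.
- apply: (@subspace_eq_continuous _ _ _ (K \o (fun p => (p.1, 2 * p.2 - 1)))).
    move=> [x t] /set_mem [[/= Ax _] t_ge]; rewrite /from_subspace /HK /=.
    case: ifPn => // t_le.
    (* At time 1/2 the two formulas agree: both give [g x] *)
    have -> : t = 2^-1 by apply/le_anti/andP.
    by rewrite mulfV ?subrr ?H1 ?K0.
  apply: continuous_comp_within Kc.
    apply: continuous_pair => p; first exact: cvg_fst.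
    by apply: cvgB; [exact: double_continuous | exact: cvg_cst].
  move=> [x t] [[/= Ax /[!in_itv] /= t01] t_ge]; split => //=; lra.
Qed.

(** The contraction of [g @^-1` U] goes from the identity to [h \o g] by the
    reverse of the given homotopy, then follows the [h]-image of the contraction
    of [U], read along [g].  During that second stage points may leave
    [g @^-1` U], which is harmless: only the inclusion into [Y] has to be
    contracted. *)
Lemma categorical_preimage (X Y : topologicalType) (g : Y -> X) (h : X -> Y)
    (U : set X) :
  continuous g -> left_homotopy_inverse R g h ->
  categorical R U -> categorical R (g @^-1` U).
Proof.
move=> gc [hc hgid] [x0 Ux0]; exists (h x0).
apply: (@homotopic_on_trans _ _ _ _ (h \o g)); last first.
  by have := homotopic_on_comp gc (fun y (gUy : (g @^-1` U) y) => gUy) hc Ux0.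
apply: homotopic_on_sym.
have id_continuous (Z : topologicalType) : continuous (@id Z) by move=> z.
exact: (homotopic_on_comp (id_continuous Y) _ (id_continuous Y) hgid).
Qed.

End Homotopies.

Section LScategory.
Variables (R : realType) (G : topologicalGroupType).
Implicit Types X Y : gSpaceType G.

Lemma categorical_cover_preimage X Y (g : Y -> X) (h : X -> Y) n :
  G_map g -> left_homotopy_inverse R g h ->
  categorical_cover R X n -> categorical_cover R Y n.
Proof.
move=> [gc gE] gh [U [Ucov Uprop]]; exists (fun i => g @^-1` U i); split.
  by rewrite -preimage_bigcup Ucov preimage_setT.
move=> i; have [Uo Uinv Ucat] := Uprop i; split.
- by apply: open_comp => // y _; exact: gc.
- by move=> a y /= Ugy; rewrite gE; exact: Uinv.
- exact: categorical_preimage gc gh Ucat.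
Qed.

(** Comparing covers of the same cardinality is enough, and it also covers the
    infinite case: if [Y] has no categorical cover, neither has [X]. *)
Lemma LScat_le X Y :
  (forall n, categorical_cover R X n -> categorical_cover R Y n) ->
  (LScat R Y <= LScat R X)%E.
Proof.
move=> XY; rewrite /LScat.
case: (pselect (exists n, `[< categorical_cover R X n >])) => [exX|_]; last first.
  by rewrite leey.
case: pselect => [exY|nexY]; last first.
  by case: nexY; have [n /asboolP/XY Yn] := exX; exists n; apply/asboolP.
rewrite lee_fin ler_nat; case: (ex_minnP exX) => m /asboolP/XY Ym _.
by case: (ex_minnP exY) => k _; apply; apply/asboolP.
Qed.

Lemma LScat_le_of_left_homotopy_inverse X Y (g : Y -> X) (h : X -> Y) :
  G_map g -> left_homotopy_inverse R g h -> (LScat R Y <= LScat R X)%E.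
Proof.
move=> gG gh; apply: LScat_le => n.
exact: categorical_cover_preimage gG gh.
Qed.

Lemma G_homotopic_homotopic X Y (f g : X -> Y) :
  G_homotopic R f g -> homotopic R f g.
Proof. by move=> [H [Hc H0 H1 _]]; exists H. Qed.

End LScategory.

Theorem theorem3p10 (R : realType) (G : topologicalGroupType)
    (X Y : gSpaceType G) :
  ((exists g : Y -> X,
      G_map g /\ exists h : X -> Y, left_homotopy_inverse R g h) ->
   (LScat R X >= LScat R Y)%E)
  /\
  (G_homotopy_equivalent R X Y -> LScat R X = LScat R Y).
Proof.
split=> [[g [gG [h gh]]]|[f [g [fG gG gf fg]]]].
  exact: LScat_le_of_left_homotopy_inverse gG gh.
apply: le_anti; apply/andP; split.
- apply: (LScat_le_of_left_homotopy_inverse (h := g) fG).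
  by split; [case: gG | exact: G_homotopic_homotopic].
- apply: (LScat_le_of_left_homotopy_inverse (h := f) gG).
  by split; [case: fG | exact: G_homotopic_homotopic].
Qed.
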